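(* There exists a function $f:\mathbb{Z}_{>0}\times\mathbb{Z}_{>0}\to\mathbb{Z}_{>0}$ with the following property. Let $m,n$ be positive integers and let $G$ be a group (not necessarily finite). If $|x^{\gamma_n(G)}|\le m$ for every $x\in G$, then $\gamma_{n+1}(G)$ is finite and $|\gamma_{n+1}(G)|\le f(m,n)$.
   Context: $\gamma_i(G)$ denotes the $i$th term of the lower central series of $G$: $\gamma_1(G)=G$ and $\gamma_{i+1}(G)=[\gamma_i(G),G]$. For $x\in G$ and a subset $S\subseteq G$, $x^S=\{x^s\mid s\in S\}$, where $x^s=s^{-1}xs$. *)

(* Defs.v *)
From mathcomp Require Import all_boot.
From mathcomp Require Import boolp classical_sets functions cardinality.

Set Implicit Arguments.
Unset Strict Implicit.
Unset Printing Implicit Defensive.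

Local Open Scope classical_set_scope.
Local Open Scope group_scope.

Section LowerCentralSeries.
Variable G : groupType.
Implicit Types A B S : set G.

Definition generated S : set G :=
  smallest (fun H : set G => group_closed (mem H)) S.

Definition commutator A B : set G :=
  generated [set [~ a, b] | a in A & b in B].

(* Indexed from 1, so that the first term is G; the value at index 0 is also G
   and carries no meaning. *)
Definition lower_central n : set G :=
  iter n.-1 (fun A => commutator A [set: G]) [set: G].

End LowerCentralSeries.

Arguments lower_central G n : clear implicits.

(* Main.v *)
Require Import Defs.
From mathcomp Require Import all_boot.
From mathcomp Require Import boolp classical_sets functions cardinality.

(* Put K = gamma_n(G).  If A and K are normal subgroups with |a^K| and |k^A|
   bounded for a in A and k in K, then [K, A] has bounded order: Neumann's
   argument bounds the number of commutators [a, k], and long products of these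
   can be shortened.  Hence it suffices to bound |k^G| for k in K.

   By B. H. Neumann's covering lemma, the elements k of K with |k^G| small
   generate a subgroup L, normal in G, of index at most m in K and with |l^G|
   bounded for l in L.  Let C be the kernel of the action of G on K/L, and put
   D_j = gamma_j(G) :&: C.  As |G : C| is bounded, one needs to bound |k^(D_1)|;
   this is done by descending from |k^(D_n)| <= m.  Given a bound for D_(i+1),
   P = [L, G][K, D_(i+1)] is finite, and A = D_n is abelian modulo P.  For
   b = [y_1, ..., y_n] the subgroup R = [A, y_1]...[A, y_n]P is finite because
   |[A, y]| <= m, and each y_j moves D_i, D_(i+1), ..., D_n, R one step down.  By
   the Hall-Witt identity [D_i, b] <= R, so |b^(D_i)| is bounded; and K is
   boundedly generated by L and such b. *)

Set Implicit Arguments.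
Unset Strict Implicit.
Unset Printing Implicit Defensive.

Local Open Scope classical_set_scope.
Local Open Scope card_scope.
Local Open Scope group_scope.

Ltac group_id := rewrite /commg /conjg
  ?(invgM, invgK, invg1, mulgA, mulgK, mulgVK, mulVg, mulgV, mul1g, mulg1).

(** * Subgroups *)

Section Subgroups.
Variable G : groupType.
Implicit Types (H K S X : set G) (x y z g : G).

Definition subgroup H :=
  [/\ H 1, forall x y, H x -> H y -> H (x * y) & forall x, H x -> H x^-1].

Lemma group_closedE H : group_closed (mem H) <-> subgroup H.
Proof.
split=> [cH|[H1 HM HV]].
  split; first by have [] := cH; rewrite inE.
  - move=> x y Hx Hy.
    by have /(_ x y) := group_closedM cH; rewrite !inE; apply.
  - by move=> x Hx; have /(_ x) := group_closedV cH; rewrite !inE; apply.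
split; first by rewrite inE.
by move=> x y; rewrite !inE => Hx Hy; apply: HM => //; apply: HV.
Qed.

Lemma sub_generated S x : S x -> generated S x.
Proof. exact: sub_gen_smallest. Qed.

Lemma generated_subgroup S : subgroup (generated S).
Proof.
split=> [H [/group_closedE[] //]|x y Sx Sy H HS|x Sx H HS].
  have [/group_closedE[_ HM _] _] := HS.
  by apply: HM; [apply: Sx|apply: Sy].
have [/group_closedE[_ _ HV] _] := HS.
by apply: HV; apply: Sx.
Qed.

Lemma generated_min S H : subgroup H -> (forall x, S x -> H x) ->
  forall x, generated S x -> H x.
Proof. by move=> /group_closedE gH SH x; apply: smallest_sub. Qed.

Lemma generated_conj S g : (forall x, S x -> generated S (x ^ g)) ->
  forall x, generated S x -> generated S (x ^ g).
Proof.
have [g1 gM gV] := generated_subgroup S.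
move=> Sg; apply: generated_min => //; split=> [|x y Sx Sy|x Sx].
- by rewrite conj1g.
- by rewrite conjMg; apply: gM.
- by rewrite conjVg; apply: gV.
Qed.

Definition normal H := subgroup H /\ forall x g, H x -> H (x ^ g).

Lemma normal_commgl H x g : normal H -> H x -> H [~ x, g].
Proof. by move=> [[_ HM HV] HJ] Hx; apply: HM; [apply: HV|apply: HJ]. Qed.

Lemma normal_commgr H x g : normal H -> H x -> H [~ g, x].
Proof.
move=> nH Hx; rewrite -invgR; have [[_ _ HV] _] := nH.
by apply: HV; apply: normal_commgl.
Qed.

Lemma normalI H K : normal H -> normal K -> normal (H `&` K).
Proof.
move=> [[H1 HM HV] HJ] [[K1 KM KV] KJ]; split; last first.
  by move=> x g [Hx Kx]; split; [apply: HJ|apply: KJ].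
split=> // [x y [Hx Kx] [Hy Ky]|x [Hx Kx]].
  by split; [apply: HM|apply: KM].
by split; [apply: HV|apply: KV].
Qed.

Lemma commutator_normal H K : normal H -> normal K -> normal (commutator H K).
Proof.
move=> [_ HJ] [_ KJ]; split; first exact: generated_subgroup.
move=> x g; apply: generated_conj => _ [a Ha [b Kb] <-].
by rewrite conjRg; apply: sub_generated; exists (a ^ g); 
  [apply: HJ|exists (b ^ g) => //; apply: KJ].
Qed.

Lemma mem_commutator H K x y : H x -> K y -> commutator H K [~ x, y].
Proof. by move=> Hx Ky; apply: sub_generated; exists x => //; exists y. Qed.

Definition setprod H K : set G := [set x * y | x in H & y in K].

Lemma setprod_subgroup H K : subgroup H -> subgroup K ->
  (forall x y, H x -> K y -> H (x ^ y)) -> subgroup (setprod H K).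
Proof.
move=> [H1 HM HV] [K1 KM KV] HJ; split.
- by exists 1 => //; exists 1; rewrite ?mulg1.
- move=> _ _ [x Hx [y Ky <-]] [x' Hx' [y' Ky' <-]].
  exists (x * x' ^ y^-1); first by apply: HM => //; apply: HJ => //; apply: KV.
  by exists (y * y'); [apply: KM|group_id].
- move=> _ [x Hx [y Ky <-]].
  exists (x^-1 ^ y); first by apply: HJ => //; apply: HV.
  by exists y^-1; [apply: KV|group_id].
Qed.

End Subgroups.


(** * Bounded sets *)

(** The list only has to cover [X]: it may repeat elements or leave [X], so bounds pass to subsets
    and images without deciding membership. *)
Definition bounded (T : eqType) (X : set T) (N : nat) :=
  exists2 r : seq T, size r <= N & forall x, X x -> x \in r.

(** Take [s] of greatest length: an [x] with [R y x] for every entry [y] could be appended to it. *)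
Lemma maximal_pairwise (T : eqType) (R : rel T) (X : set T) (N : nat) :
  (forall s, (forall x, x \in s -> X x) -> pairwise R s -> size s <= N) ->
  exists s, [/\ size s <= N, forall x, x \in s -> X x &
    forall x, X x -> exists2 y, y \in s & ~~ R y x].
Proof.
move=> ub.
pose P n := `[< exists s, [/\ size s = n, forall x, x \in s -> X x &
                              pairwise R s] >].
have exP : exists n, P n by exists 0; apply/asboolP; exists [::].
have ubP n : P n -> n <= N by move/asboolP=> [s [<- sX Rs]]; apply: ub.
case: (ex_maxnP exP ubP) => n /asboolP[s [ss sX Rs]] maxn.
exists s; split=> // [|x Xx]; first by rewrite ss; apply: ubP; apply/asboolP; exists s.
apply/allPn/negP => all_s.
have : P n.+1.
  apply/asboolP; exists (rcons s x); split; first by rewrite size_rcons ss.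
    by move=> y; rewrite mem_rcons inE => /predU1P[->//|]; apply: sX.
  by rewrite pairwise_rcons all_s.
by move/maxn; rewrite ltnn.
Qed.

Section Bounded.
Variable T : eqType.
Implicit Types (X Y : set T) (M N : nat).

Lemma bounded_sub X Y N : X `<=` Y -> bounded Y N -> bounded X N.
Proof. by move=> XY [r sr Yr]; exists r => // x /XY /Yr. Qed.

Lemma bounded_le X M N : M <= N -> bounded X M -> bounded X N.
Proof. by move=> MN [r sr Xr]; exists r => //; apply: leq_trans MN. Qed.

Lemma bounded1 x : bounded [set x : T] 1.
Proof. by exists [:: x] => // _ ->; rewrite inE. Qed.

Lemma bounded_uniq X N s : bounded X N -> uniq s ->
  (forall x, x \in s -> X x) -> size s <= N.
Proof.
move=> [r sr Xr] us sX; apply: leq_trans sr.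
by apply: uniq_leq_size => // x /sX /Xr.
Qed.

Lemma uniq_bounded X N :
  (forall s, (forall x, x \in s -> X x) -> uniq s -> size s <= N) ->
  bounded X N.
Proof.
move=> ub; have [|s [ss sX maxs]] := @maximal_pairwise T [rel x y | x != y] X N.
  by move=> s sX; rewrite -uniq_pairwise; apply: ub.
exists s => // x /maxs[y ys] /=; rewrite negbK => /eqP <- //.
Qed.

Lemma bounded_bigcup (I : eqType) (D : set I) (F : I -> set T) M N :
  bounded D M -> (forall i, D i -> bounded (F i) N) ->
  bounded (\bigcup_(i in D) F i) (M * N).
Proof.
move=> [r sr Dr] FN.
suff [s ss sF] : exists2 s : seq T, size s <= size r * N &
    forall i, i \in r -> D i -> forall x, F i x -> x \in s.
  exists s; first by apply: leq_trans ss _; rewrite leq_mul2r sr orbT.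
  by move=> x [i Di Fx]; apply: (sF i) => //; apply: Dr.
elim: r {sr Dr} => [|i r [s ss sF]]; first by exists [::].
have [Di|nDi] := pselect (D i); last first.
  exists s => [|j]; first by rewrite mulSn (leq_trans ss) ?leq_addl.
  by rewrite inE => /predU1P[-> //|]; apply: sF.
have [t st tF] := FN i Di; exists (t ++ s).
  by rewrite size_cat mulSn leq_add.
move=> j; rewrite inE => /predU1P[-> _ x /tF|jr Dj x Fx]; rewrite mem_cat.
  by move->.
by rewrite (sF j) ?orbT.
Qed.

Lemma bounded_image (I : eqType) (D : set I) (f : I -> T) N :
  bounded D N -> bounded [set f i | i in D] N.
Proof.
move=> bD; rewrite -[N]muln1.
apply: bounded_sub (bounded_bigcup bD (fun i _ => bounded1 (f i))).
by move=> _ [i Di <-]; exists i.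
Qed.

Lemma bounded_image2 (I J : eqType) (D : set I) (E : set J) (f : I -> J -> T)
    M N :
  bounded D M -> bounded E N -> bounded [set f i j | i in D & j in E] (M * N).
Proof.
move=> bD bE.
apply: bounded_sub (bounded_bigcup bD (fun i _ => bounded_image (f i) bE)).
by move=> _ [i Di [j Ej <-]]; exists i => //; exists j.
Qed.

Lemma bounded_fibers (I : eqType) (D : set I) (f : I -> T) N :
  bounded [set f i | i in D] N ->
  exists r : seq I, [/\ size r <= N, forall i, i \in r -> D i &
    forall i, D i -> exists2 j, j \in r & f j = f i].
Proof.
move=> bf; have [|s [ss sD maxs]] :=
    @maximal_pairwise I [rel i j | f i != f j] D N.
  move=> s sD pw; rewrite -(size_map f); apply: bounded_uniq bf _ _.
    by rewrite uniq_pairwise pairwise_map.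
  by move=> _ /mapP[i /sD Di ->]; exists i.
exists s; split=> // i /maxs[j js /=]; rewrite negbK => /eqP fij.
by exists j.
Qed.

End Bounded.

(** * Products of boundedly many letters *)

Section Products.
Variable G : groupType.
Implicit Types (X : set G) (d e : nat) (x y z : G) (s : seq G).

Definition products X d : set G :=
  [set y | exists s, [/\ size s = d, forall x, x \in s -> X x &
                        y = \prod_(x <- s) x]].

Lemma products_cat X d e x y :
  products X d x -> products X e y -> products X (d + e) (x * y).
Proof.
move=> [s [<- sX ->]] [t [<- tX ->]]; exists (s ++ t).
split; rewrite ?size_cat ?big_cat // => z.
by rewrite mem_cat => /orP[/sX|/tX].
Qed.

Lemma products0 X y : products X 0 y <-> y = 1.
Proof.
split=> [[s [/size0nil -> _ ->]]|->]; first by rewrite big_nil.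
by exists [::]; rewrite big_nil.
Qed.

Lemma products1 X x : X x -> products X 1 x.
Proof.
by move=> Xx; exists [:: x]; rewrite big_seq1; split=> // y; rewrite inE => /eqP->.
Qed.

Lemma products_exp X x d : X x -> products X d (x ^+ d).
Proof.
move=> Xx; elim: d => [|d IHd]; first by apply/products0.
by rewrite expgS -add1n; apply: products_cat IHd; apply: products1.
Qed.

Lemma products_rcons X d y : products X d.+1 y ->
  exists2 z, products X d z & exists2 x, X x & y = z * x.
Proof.
move=> [s []]; case/lastP: s => // s x; rewrite size_rcons => -[ss] sX ->.
exists (\prod_(x <- s) x).
  by exists s; split=> // z zs; apply: sX; rewrite mem_rcons inE zs orbT.
exists x; first by apply: sX; rewrite mem_rcons mem_head.
by rewrite -cats1 big_cat big_seq1.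
Qed.

Lemma products_le X d e y : X 1 -> d <= e -> products X d y -> products X e y.
Proof.
move=> X1 /subnKC <- Xy; rewrite -[y]mulg1; apply: products_cat Xy _.
by rewrite -(expg1n _ (e - d)); apply: products_exp.
Qed.

Lemma products_stable X d : X 1 ->
  products X d.+1 `<=` products X d -> forall e, products X e `<=` products X d.
Proof.
move=> X1 Xd; elim=> [y|e IHe y]; first exact: products_le.
move=> /products_rcons[z /IHe Xz [x Xx ->]]; apply: Xd; rewrite -addn1.
by apply: products_cat Xz _; apply: products1.
Qed.

Lemma generated_products X y : X 1 -> (forall x, X x -> X x^-1) ->
  generated X y -> exists d, products X d y.
Proof.
move=> X1 XV; apply: (@generated_min _ _ [set y | exists d, products X d y]).
  split=> [|x z [d Xx] [e Xz]|x [d]]; first by exists 0; apply/products0.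
    by exists (d + e); apply: products_cat.
  elim: d x => [|d IHd] x; first by move/products0->; exists 0; apply/products0; rewrite invg1.
  move/products_rcons=> [z /IHd[e Xz] [w Xw ->]]; exists (1 + e).
  by rewrite invgM; apply: products_cat Xz; apply/products1/XV.
by move=> x Xx; exists 1%N; apply: products1.
Qed.

Lemma products_generated X d y : products X d y -> generated X y.
Proof.
have [g1 gM _] := generated_subgroup X.
elim: d y => [|d IHd] y; first by move/products0->.
move=> /products_rcons[z /IHd Xz [x Xx ->]]; apply: gM => //.
exact: sub_generated.
Qed.

Lemma bounded_products X e d : bounded X e -> bounded (products X d) (e ^ d)%N.
Proof.
move=> Xe; elim: d => [|d IHd].
  by apply: bounded_sub (bounded1 1) => y /products0.
rewrite expnSr; apply: bounded_sub (bounded_image2 _ IHd Xe) => y.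
by move=> /products_rcons[z Xz [x Xx ->]]; exists z => //; exists x.
Qed.

(* If a product of [2m] letters cannot be shortened, its even-length prefixes
   are [m + 1] elements no two of which differ by a letter. *)
Lemma products_of_separated X m : X 1 -> (forall x, X x -> X x^-1) ->
  (forall s, (forall x, x \in s -> generated X x) ->
     pairwise (fun x y => ~~ `[< X (x^-1 * y) >]) s -> size s <= m) ->
  generated X `<=` products X m.*2.
Proof.
move=> X1 XV sep y /(generated_products X1 XV)[d]; apply: products_stable => // {d y}.
have chain t z : products X t.*2 z ->
    (forall d, d < t.*2 -> ~ products X d z) ->
  exists s, [/\ size s = t.+1, forall x, x \in s -> products X t.*2 x &
                pairwise (fun x y => ~~ `[< X (x^-1 * y) >]) s].
  elim: t z => [|t IHt] z.
    move=> Xz _; exists [:: z]; split=> // x.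
    by rewrite inE => /eqP->.
  move=> /products_rcons[w Xw [x Xx def_z]] minz.
  have /products_rcons[v Xv [x' Xx' def_w]] := Xw.
  have [d dt Xv'|s [ss sX sep_s]] := IHt v Xv.
    apply: (minz d.+2); first by rewrite doubleS.
    rewrite def_z def_w -addn1; apply: products_cat; last exact: products1.
    by rewrite -addn1; apply: products_cat => //; apply: products1.
  exists (rcons s z); rewrite size_rcons ss; split=> //.
    move=> u; rewrite mem_rcons inE => /predU1P[->|/sX Xu]; last first.
      by apply: products_le Xu => //; rewrite leq_double.
    rewrite def_z doubleS -addn1.
    by apply: products_cat => //; apply: products1.
  rewrite pairwise_rcons sep_s andbT; apply/allP => u /sX Xu.
  apply/asboolP => Xuz; apply: (minz t.*2.+1); first by rewrite doubleS.
  by rewrite -(mulVKg u z) -addn1; apply: products_cat => //; apply: products1.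
have short : products X m.*2 `<=` products X m.*2.-1.
  move=> z Xz; have [//|nXz] := pselect (products X m.*2.-1 z).
  have [d dm Xz'|s [ss sX sep_s]] := chain m z Xz.
    by apply: nXz; apply: products_le Xz' => //; case: m.*2 dm.
  suff: size s <= m by rewrite ss ltnn.
  apply: sep => // x /sX.
  exact: products_generated.
move=> z /products_rcons[w /short Xw [x Xx ->]].
(* Positivity of [m] makes [m.*2.-1] letters and one more add up to [m.*2]. *)
have m_gt0 : 0 < m.
  by apply: (sep [:: 1]) => // u; rewrite inE => /eqP->; apply: sub_generated.
rewrite -(prednK (n := m.*2)) ?double_gt0 // -addn1.
by apply: products_cat Xw _; apply: products1.
Qed.

End Products.

(** * Commutators of subgroups with bounded mutual orbits *)

Section BFC.
Variable G : groupType.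
Implicit Types (A K : set G) (a k x y z : G) (m N e : nat).

Lemma bounded_map (T : eqType) A (f : G -> G -> T) (s : seq G) N :
  (forall b, b \in s -> bounded [set f b a | a in A] N) ->
  bounded [set [seq f b a | b <- s] | a in A] (N ^ size s)%N.
Proof.
elim: s => [|b s IHs] sN.
  by apply: bounded_sub (bounded1 [::]) => _ [a _ <-].
have bb := sN b (mem_head _ _).
have bs := IHs (fun x xs => sN x (mem_behead (s := b :: s) xs)).
rewrite /= expnS; apply: bounded_sub (bounded_image2 cons bb bs).
by move=> _ [a Aa <-]; exists (f b a); [exists a|exists [seq f b a | b <- s] => //; exists a].
Qed.

(* Neumann's argument: take [a] in [A] with the largest [a ^ K], and let the
   [b_i] realise its elements.  For [u] in [A] centralising every [b_i], the
   elements [(u * a) ^ b_i = u * a ^ b_i] exhaust [(u * a) ^ K], so [~ u, k] is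
   one of the [a ^ b_i / a ^ k]. *)
Lemma bounded_commutators A K m N :
  normal A -> normal K ->
  (forall a, A a -> bounded [set a ^ k | k in K] m) ->
  (forall k, K k -> bounded [set k ^ a | a in A] N) ->
  bounded [set [~ a, k] | a in A & k in K] (N.+1 ^ m * (m * m * m))%N.
Proof.
move=> [[A1 AM AV] AJ] [_ KJ] Am KN.
pose P n := `[< exists a s, [/\ size s = n, A a, forall b, b \in s -> K b &
                              uniq [seq a ^ b | b <- s]] >].
have exP : exists n, P n by exists 0; apply/asboolP; exists 1, [::].
have ubP n : P n -> n <= m.
  move=> /asboolP[a [s [<- Aa sK us]]]; rewrite -(size_map (conjg a)).
  apply: bounded_uniq (Am a Aa) us _ => _ /mapP[b /sK Kb ->]; by exists b.
case: (ex_maxnP exP ubP) => r /[dup] /ubP rm /asboolP[a [s [ss Aa sK us]]] maxr.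
have Uk u k : A u -> K k -> (forall b, b \in s -> b ^ u = b) ->
    exists2 b, K b & [~ u, k] = a ^ b / a ^ k.
  move=> Au Kk us_fix.
  have ub b : b \in s -> (u * a) ^ b = u * a ^ b.
    move=> bs; rewrite conjMg; congr (_ * _); apply/eqP.
    by rewrite conjg_fix commg1_sym -conjg_fix us_fix ?eqxx.
  have [|nin] := boolP ((u * a) ^ k \in [seq (u * a) ^ b | b <- s]).
    move=> /mapP[b bs]; rewrite (ub b bs) conjMg => eq_uk; exists b; first exact: sK.
    by apply: (mulIg (a ^ k)); rewrite mulgVK commgEl -mulgA eq_uk mulKg.
  have : P r.+1.
    apply/asboolP; exists (u * a), (k :: s); rewrite /= ss nin; split=> //.
    - exact: AM.
    - by move=> b; rewrite inE => /predU1P[->|/sK].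
    have -> : [seq (u * a) ^ b | b <- s] = map (mul u) [seq a ^ b | b <- s].
      by rewrite -map_comp; apply/eq_in_map => b /ub.
    by rewrite map_inj_uniq //; apply: mulgI.
  by move/maxr; rewrite ltnn.
(* Elements of [A] with the same tuple of conjugates [b ^ a], for [b] in [s], differ by an element
   centralising [s]. The positive base [N.+1] lets the exponent grow from [size s] to [m]. *)
have bA : bounded [set [seq b ^ a | b <- s] | a in A] (N.+1 ^ m)%N.
  apply: bounded_le (bounded_map (N := N.+1) _).
    by rewrite ss leq_pexp2l.
  by move=> b /sK Kb; apply: bounded_le (KN b Kb).
have [T [sT TA repT]] := bounded_fibers bA.
have baK := Am a Aa.
have bT : bounded [set` T] (N.+1 ^ m)%N by exists T.
(* These sets reflect [[~ c, k] = [~ c / t, k] ^ t * [~ t, k]]: by [Uk] the first commutator takes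
   at most [m * m] values, and [[~ t, k] = t^-1 * t ^ k] at most [m]. *)
have bD t : A t -> bounded [set x ^ t * (t^-1 * y) | x in
    [set x / y | x in [set a ^ k | k in K] & y in [set a ^ k | k in K]] &
    y in [set t ^ k | k in K]] (m * m * m)%N.
  move=> At; apply: bounded_image2 (Am t At).
  exact: bounded_image2.
have := bounded_bigcup bT (fun t (tT : [set` T] t) => bD t (TA t tT)).
apply: bounded_sub => _ [c Ac [k Kk <-]].
have [t tT fix_t] := repT c Ac; exists t => //=.
have Act : A (c / t) by apply: AM => //; apply: AV; apply: TA.
have ct_fix b : b \in s -> b ^ (c / t) = b.
  move=> bs; rewrite conjgM; have /eq_in_map/(_ b bs) <- := fix_t.
  by rewrite conjgK.
have [b Kb Euk] := Uk (c / t) k Act Kk ct_fix.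
exists [~ c / t, k].
  by rewrite Euk; exists (a ^ b); [exists b|exists (a ^ k) => //; exists k].
exists (t ^ k); first by exists k.
by group_id.
Qed.

(** As [[~ a, k * k] = [~ a, k] * [~ a, k] ^ k], the right side is [[~ a, k]] times the
    [k]-conjugate of its power [n.+1], which [k] fixes. It uses [n.+1] letters in place of
    [n.+2]. *)
Lemma commg_exp a k (n : nat) : commute ([~ a, k] ^+ n.+1) k ->
  [~ a, k] ^+ n.+2 = [~ a, k * k] * [~ a ^ k, k] ^+ n.
Proof.
move=> cz; have -> : [~ a ^ k, k] = [~ a, k] ^ k by group_id.
rewrite -conjXg expgS {1}/commg /conjg -!mulgA -cz expgS.
by group_id.
Qed.

(** Moving [z] to the front conjugates the letters it passes; they stay in [X] and their number does
    not change. *)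
Lemma prod_gather (X : set G) z c (s : seq G) :
  (forall x y, X x -> X (x ^ y)) -> (forall x, x \in s -> X x) ->
  c <= count_mem z s ->
  exists t, [/\ size t = (size s - c)%N, forall x, x \in t -> X x &
    \prod_(x <- s) x = z ^+ c * \prod_(x <- t) x].
Proof.
move=> XJ; elim: s c => [|y s IHs] c sX.
  by rewrite leqn0 => /eqP->; exists [::]; rewrite mul1g.
have sX' x : x \in s -> X x by move=> xs; apply: sX; rewrite inE xs orbT.
have Xy : X y by apply: sX; rewrite mem_head.
have [eq_yz|nyz] /= := eqVneq y z.
  case: c => [|c].
    by move=> _; exists (y :: s); rewrite mul1g subn0.
  rewrite eq_yz eqxx add1n ltnS => le_c; have [t [st tX def_t]] := IHs c sX' le_c; exists t.
  by rewrite big_cons def_t mulgA -expgS subSS.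
rewrite (negbTE nyz) add0n => le_c; have [t [st tX def_t]] := IHs c sX' le_c.
exists (y ^ (z ^+ c) :: t); split=> /=.
- by rewrite st subSn // (leq_trans le_c) ?count_size.
- by move=> x; rewrite inE => /predU1P[->|/tX //]; apply: XJ.
by rewrite !big_cons def_t; group_id.
Qed.

Lemma frequent_letter (s r : seq G) q :
  (forall x, x \in s -> x \in r) -> size r * q < size s ->
  exists2 z, z \in s & q < count_mem z s.
Proof.
move=> sr ltrs; apply/hasP; rewrite -[has _ _]negbK; apply/negP => /hasPn no.
move: ltrs; rewrite ltnNge => /negP[].
have {}no x : count_mem x s <= q.
  have [/no|/count_memPn -> //] := boolP (x \in s); by rewrite -leqNgt.
elim: r s sr no => [|x r IHr] s sr no; first by case: s sr {no} => // y s /(_ y (mem_head _ _)).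
rewrite /= mulSn -(count_predC (pred1 x) s) leq_add // -size_filter.
apply: IHr => [y|y].
  by rewrite mem_filter => /andP[/= nyx /sr]; rewrite inE (negbTE nyx).
by rewrite count_filter (leq_trans _ (no y)) // sub_count // => z /andP[].
Qed.

(* Let [e] bound the number of letters [~ a, k].  A letter occurring more than
   [e`!] times in a product can be gathered into a power, which [commg_exp]
   replaces by a shorter product: its [e`!]-th power commutes with [k], since two
   of the [e.+1] letters [~ z ^+ i, k] coincide. *)
Lemma bounded_commutator A K e :
  normal A -> normal K -> bounded [set [~ a, k] | a in A & k in K] e ->
  bounded (commutator A K) (e ^ (e * e`!))%N.
Proof.
move=> nA nK be; have [[A1 AM AV] AJ] := nA; have [[K1 KM KV] KJ] := nK.
set X := (X in bounded X e) in be.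
have XJ x y : X x -> X (x ^ y).
  move=> [a Aa [k Kk <-]]; rewrite conjRg; exists (a ^ y); first exact: AJ.
  by exists (k ^ y) => //; apply: KJ.
have X1 : X 1 by exists 1 => //; exists 1; rewrite ?commg1.
have XV x : X x -> X x^-1.
  move=> [a Aa [k Kk <-]]; exists (a^-1 ^ a); first by apply/AJ/AV.
  by exists (k ^ a); [apply: KJ|group_id].
apply: bounded_sub (bounded_products (e * e`!) be) => y.
move=> /(generated_products X1 XV)[d]; apply: products_stable => // {d y}.
move=> _ [s [ss sX ->]].
have [r sr Xr] := be.
have [||z /sX Xz lt_z] := @frequent_letter s r e`!.
- by move=> x /sX/Xr.
- by rewrite ss ltnS leq_mul2r sr orbT.
have [t [st tX ->]] := prod_gather XJ sX lt_z.
have -> : (e * e`! = e`! + (e * e`! - e`!))%N.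
  rewrite subnKC // leq_pmull //; apply: leq_trans sr.
  by case: (r) (Xr 1 X1).
apply: products_cat; last by exists t; rewrite st ss subSS.
have [a Aa [k Kk def_z]] := Xz.
have Az : A z by rewrite -def_z; apply: normal_commgl.
have [d d_gt0 [de cd]] : exists2 d, 0 < d & d <= e /\ commute (z ^+ d) k.
  pose f i := [~ z ^+ i, k].
  have AX i : A (z ^+ i) by elim: i => [|i IHi]; rewrite ?expgS //; apply: AM.
  have : ~~ uniq (mkseq f e.+1).
    apply/negP => uf; suff: size (mkseq f e.+1) <= e by rewrite size_mkseq ltnn.
    by apply: bounded_uniq be uf _ => _ /mapP[i _ ->]; exists (z ^+ i) => //; exists k.
  move=> /(uniqPn 1)[i [j []]]; rewrite size_mkseq => ltij ltj.
  rewrite !nth_mkseq ?(ltn_trans ltij) // => eq_f.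
  exists (j - i)%N; first by rewrite subn_gt0.
  split; first by rewrite leq_subLR (leq_trans _ (leq_addl _ _)).
  rewrite /f -(subnK (ltnW ltij)) expgnDr in eq_f.
  apply/commgP/eqP; move: eq_f.
  move: (z ^+ (j - i)) (z ^+ i) => w x.
  have -> : [~ w * x, k] = x^-1 * ([~ w, k] * x ^ k) by group_id.
  by rewrite (commgEl x) => /mulgI; rewrite -{1}[x ^ k]mul1g => /mulIg <-.
have [f f_gt0 def_f] : exists2 f, 0 < f & e`! = (d * f)%N.
  have /dvdnP[f def_f] : d %| e`! by rewrite dvdn_fact // d_gt0.
  exists f; last by rewrite def_f mulnC.
  by move: (fact_gt0 e); rewrite def_f; case: f {def_f}.
have cq : commute (z ^+ e`!) k.
  by rewrite def_f expgnA; apply/commute_sym/commuteX/commute_sym.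
(* With [q.+1] for the factorial, the gathered power [z ^+ q.+2] becomes [1 + q] letters. *)
move: cq (fact_gt0 e); case: (e`!) => // q cq _.
rewrite -def_z commg_exp ?def_z // -[q.+1]add1n.
apply: products_cat; last by apply: products_exp; exists (a ^ k); [apply: AJ|exists k].
by apply: products1; exists a => //; exists (k * k) => //; apply: KM.
Qed.

End BFC.

Lemma normalT (G : groupType) : normal [set: G].
Proof. by []. Qed.

Lemma commutatorC (G : groupType) (A B : set G) :
  commutator A B `<=` commutator B A.
Proof.
have gBA := generated_subgroup [set [~ b, a] | b in B & a in A].
apply: generated_min => // _ [a Aa [b Bb <-]].
by rewrite -invgR; have [_ _] := gBA; apply; apply: mem_commutator.
Qed.

Definition bfc_bound m N :=
  let e := (N.+1 ^ m * (m * m * m))%N in (e ^ (e * e`!))%N.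

Lemma bounded_bfc (G : groupType) (A K : set G) m N :
  normal A -> normal K ->
  (forall a, A a -> bounded [set a ^ k | k in K] m) ->
  (forall k, K k -> bounded [set k ^ a | a in A] N) ->
  bounded (commutator K A) (bfc_bound m N).
Proof.
move=> nA nK Am KN; apply: bounded_sub (@commutatorC _ K A) _.
by apply: bounded_commutator => //; apply: bounded_commutators.
Qed.

(** * Elements with small conjugacy classes *)

(** The recursion of [conj_cover], with [d] centralisers and [s] cosets: either the first class has
    at most [s] elements, or its centraliser is eliminated and at most [s + s * s] cosets of the
    others remain. *)
Fixpoint cover_bound d s :=
  if d is d'.+1 then (s + cover_bound d' (s + s * s))%N else 0.

Lemma leq_cover_bound d e s t : d <= e -> s <= t ->
  cover_bound d s <= cover_bound e t.
Proof.
elim: d e s t => [|d IHd] [|e] s t //= de st.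
by rewrite leq_add // IHd // leq_add // leq_mul.
Qed.

Section ClassCover.
Variable G : groupType.
Implicit Types (K L X S : set G) (x y z k g : G).

(* The set of [x] with [z ^ x = c] is a coset of the centraliser of [z], so this
   is B. H. Neumann's lemma on coverings of a group by cosets. *)
Lemma conj_cover (zs : seq G) (ps : seq (G * G)) :
  (forall p, p \in ps -> p.1 \in zs) ->
  (forall x, exists2 p, p \in ps & p.1 ^ x = p.2) ->
  exists2 z, z \in zs &
    bounded [set z ^ x | x in [set: G]] (cover_bound (size zs) (size ps)).
Proof.
suff cov s : size ps <= s -> (forall p, p \in ps -> p.1 \in zs) ->
    (forall x, exists2 p, p \in ps & p.1 ^ x = p.2) ->
    exists2 z, z \in zs &
      bounded [set z ^ x | x in [set: G]] (cover_bound (size zs) s).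
  exact: cov.
elim: zs ps s => [|z0 zs IHzs] ps s ss ps_zs cov.
  by have [p /ps_zs] := cov 1.
have [b0|unb] := pselect (bounded [set z0 ^ x | x in [set: G]] s).
  by exists z0; rewrite ?mem_head //; apply: bounded_le b0; apply: leq_addr.
pose cs := [seq p.2 | p <- ps & p.1 == z0].
have ss_cs : size cs <= s.
  by rewrite size_map size_filter; apply: leq_trans (count_size _ _) ss.
(* The coset of [g] modulo the centraliser of [z0] is not one of the given ones, so cosets belonging
   to other elements cover it. *)
have /existsNP[g /negP gcs] : ~ forall x, z0 ^ x \in cs.
  by move=> all_cs; apply: unb; exists cs => // _ [x _ <-].
pose ps' := [seq p <- ps | p.1 != z0].
have ss' : size ps' <= s.
  by rewrite size_filter; apply: leq_trans (count_size _ _) ss.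
pose w c := xget 1 [set x | z0 ^ x = c].
(* Translating that covering by [g^-1 * w c] covers the coset of all [x] with [z0 ^ x = c]. When [c]
   is not conjugate to [z0], [w c] is the harmless default 1. *)
pose ps2 := ps' ++ [seq (p.1, p.2 ^ (g^-1 * w c)) | p <- ps', c <- cs].
have ps'_zs p : p \in ps' -> p.1 \in zs.
  rewrite mem_filter => /andP[nz0 /ps_zs]; by rewrite inE (negbTE nz0).
have [|p|x|z zzs bz] := IHzs ps2 (s + s * s)%N.
- by rewrite size_cat size_allpairs leq_add // leq_mul.
- rewrite mem_cat => /orP[/ps'_zs //|/allpairsP[[q c] [/= qps' _ ->]]].
  by move: (ps'_zs q qps').
- have [p pps px] := cov x; have [pz|npz] := eqVneq p.1 z0; last first.
    by exists p => //; rewrite mem_cat mem_filter npz pps.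
  have p2cs : p.2 \in cs by apply/mapP; exists p; rewrite // mem_filter pz eqxx.
  have w_p : z0 ^ w p.2 = p.2.
    by apply: (@xgetPex _ 1 [set x | z0 ^ x = p.2]); exists x; rewrite -pz.
  have fix_z0 : z0 ^ (x * (w p.2)^-1) = z0.
    have z0x : z0 ^ x = z0 ^ w p.2 by rewrite w_p -pz.
    by rewrite conjgM z0x conjgK.
  have [q qps qx] := cov (x * (w p.2)^-1 * g).
  have nqz : q.1 != z0.
    apply: contra gcs => /eqP qz; apply/mapP; exists q.
      by rewrite mem_filter qz eqxx.
    by rewrite -qx qz conjgM fix_z0.
  exists (q.1, q.2 ^ (g^-1 * w p.2)).
    rewrite mem_cat; apply/orP; right; apply/allpairsP; exists (q, p.2) => /=.
    by rewrite mem_filter nqz qps p2cs.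
  by rewrite /= -qx; group_id.
exists z; first by rewrite inE zzs orbT.
by apply: bounded_le bz; apply: leq_addl.
Qed.

Lemma bounded_conjM S x y M N :
  bounded [set x ^ s | s in S] M -> bounded [set y ^ s | s in S] N ->
  bounded [set (x * y) ^ s | s in S] (M * N).
Proof.
move=> bx by_; apply: bounded_sub (bounded_image2 mul bx by_) => _ [s Ss <-].
by exists (x ^ s); [exists s|exists (y ^ s); [exists s|rewrite conjMg]].
Qed.

Lemma bounded_conjV S x N :
  bounded [set x ^ s | s in S] N -> bounded [set x^-1 ^ s | s in S] N.
Proof.
move=> bx; apply: bounded_sub (bounded_image (fun y : G => y^-1) bx) => _ [s Ss <-].
exists (x ^ s); first by exists s.
by rewrite conjVg.
Qed.

Lemma bounded_conj1 S N : 0 < N -> bounded [set 1 ^ s | s in S] N.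
Proof.
move=> N_gt0; apply: bounded_le N_gt0 _.
by apply: bounded_sub (bounded1 1) => _ [s _ <-]; rewrite conj1g.
Qed.

Lemma bounded_conj_products S X d x N :
  (forall z, X z -> bounded [set z ^ s | s in S] N) -> products X d x ->
  bounded [set x ^ s | s in S] (N ^ d)%N.
Proof.
move=> XN; elim: d x => [|d IHd] x; first by move/products0->; apply: bounded_conj1.
move=> /products_rcons[y Xy [z Xz ->]].
by rewrite expnSr; apply: bounded_conjM; [apply: IHd|apply: XN].
Qed.

(** For a subgroup [X] of [K] this says that its index is at most [m]; [X] may also be a mere set of
    letters. *)
Definition separated X K m :=
  forall s : seq G, (forall x, x \in s -> K x) ->
    pairwise (fun x y => ~~ `[< X (x^-1 * y) >]) s -> size s <= m.

Lemma sub_separated X X' K K' m : X `<=` X' -> K' `<=` K ->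
  separated X K m -> separated X' K' m.
Proof.
move=> XX' KK' sep s sK' sX'; apply: sep => [x /sK'/KK' //|].
by apply: sub_pairwise sX' => x y; apply: contra => /asboolP/XX' ?; apply/asboolP.
Qed.

Lemma separated_reps X K m : separated X K m ->
  exists r : seq G, [/\ size r <= m, forall x, x \in r -> K x &
    forall x, K x -> exists2 y, y \in r & X (y^-1 * x)].
Proof.
move=> /maximal_pairwise[r [sr rK maxr]]; exists r; split=> // x /maxr[y yr].
by rewrite negbK => /asboolP; exists y.
Qed.

(** By [products_of_separated], [m.*2] letters suffice for every element, and bounds on conjugates
    multiply. *)
Lemma bounded_conj_generated S K X m N : 0 < N -> subgroup K ->
  (forall x, X x -> K x) -> separated X K m ->
  (forall x, X x <-> K x /\ bounded [set x ^ s | s in S] N) ->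
  forall x, generated X x -> bounded [set x ^ s | s in S] (N ^ m.*2)%N.
Proof.
move=> N_gt0 sK XK sep defX x Xx; have [K1 KM KV] := sK.
apply: (@bounded_conj_products _ X); first by move=> z /defX[].
apply: (@products_of_separated _ X m) Xx.
- by apply/defX; split=> //; apply: bounded_conj1.
- by move=> y /defX[Ky by_]; apply/defX; split; [apply: KV|apply: bounded_conjV].
by apply: sub_separated sep => //; apply: generated_min.
Qed.

(** From [m.+1] elements arise at most [m.+1 * m.+1] quotients, whose centralisers are to cover the
    group; the successor makes the bound positive. *)
Definition class_bound m := (cover_bound (m.+1 * m.+1) (m.+1 * m.+1)).+1.

(** Suppose no quotient of [m.+1] elements of [K] has a small class. By [conj_cover] the
    centralisers of the quotients do not cover [G], and an [x] outside them has [m.+1] distinct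
    conjugates under [K]. *)
Lemma small_class_separated K m :
  (forall x, bounded [set x ^ k | k in K] m) -> subgroup K ->
  separated [set k | K k /\ bounded [set k ^ g | g in [set: G]] (class_bound m)]
    K m.
Proof.
move=> Km [_ KM KV] s sK pw_s; rewrite leqNgt; apply/negP => lt_ms.
pose t := take m.+1 s; have st : size t = m.+1 by rewrite size_takel.
have tK x : x \in t -> K x by move/mem_take/sK.
set F := [set k | _] in pw_s.
pose zs := [seq z <- [seq x^-1 * y | x <- t, y <- t] | ~~ `[< F z >]].
have zsF z : z \in zs -> ~ F z by rewrite mem_filter => /andP[/asboolP].
have zsK z : z \in zs -> K z.
  rewrite mem_filter => /andP[_ /allpairsP[[x y] [/= xt yt ->]]].
  by apply: KM; [apply: KV|]; apply: tK.
have szs : size zs <= m.+1 * m.+1.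
  by rewrite size_filter (leq_trans (count_size _ _)) // size_allpairs st.
have [x xzs] : exists x, forall z, z \in zs -> z ^ x != z.
  apply: contrapT => no_x.
  have [p||z zzs bz] := @conj_cover zs [seq (z, z) | z <- zs].
  - by move=> /mapP[z zzs ->].
  - move=> x; apply: contrapT => nox; apply: no_x; exists x => z zzs.
    by apply/eqP => zx; apply: nox; exists (z, z) => //; apply/mapP; exists z.
  apply: (zsF z zzs); split; first exact: zsK.
  apply: bounded_le bz; rewrite size_map; apply: leqW.
  exact: leq_cover_bound.
suff: size t <= m by rewrite st ltnn.
rewrite -(size_map (fun k => x ^ k^-1)).
apply: bounded_uniq (Km x) _ _; last first.
  by move=> _ /mapP[k /tK Kk ->]; exists k^-1 => //; apply: KV.
rewrite uniq_pairwise pairwise_map.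
have pw_t : pairwise (fun x y => ~~ `[< F (x^-1 * y) >]) t.
  exact: subseq_pairwise (take_subseq _ _) pw_s.
apply: (sub_in_pairwise (P := mem t)) pw_t; last exact/allP.
move=> a b ta tb Fab; apply/negP => /eqP /= eq_ab.
have /xzs/negP[] : a^-1 * b \in zs.
  by rewrite mem_filter Fab; apply/allpairsP; exists (a, b).
by rewrite conjg_fix commg1_sym -conjg_fix conjgM eq_ab conjgKV.
Qed.

Lemma fc_subgroup K m :
  normal K -> (forall x, bounded [set x ^ k | k in K] m) ->
  exists L, [/\ normal L, L `<=` K, separated L K m &
    forall l, L l ->
      bounded [set l ^ g | g in [set: G]] (class_bound m ^ m.*2)%N].
Proof.
move=> [sK KJ] Km; have sep := small_class_separated Km sK.
set F := [set k | _] in sep; exists (generated F); split.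
- split; first exact: generated_subgroup.
  move=> x g; apply: generated_conj => {}x [Kx bx].
  apply: sub_generated; split; first exact: KJ.
  apply: bounded_sub bx => _ [h _ <-]; exists (g * h) => //.
  by rewrite conjgM.
- by apply: generated_min => // x [].
- by apply: sub_separated sep => // x; apply: sub_generated.
- by apply: (@bounded_conj_generated _ K) => // x [].
Qed.

End ClassCover.

(** * The lower central series *)

Section LowerCentral.
Variable G : groupType.
Implicit Types (A T S : set G) (x y g : G) (n i j : nat).

Lemma commutes_mod_subgroup T S : normal T ->
  subgroup [set a | forall g, S g -> T [~ a, g]].
Proof.
move=> [[T1 TM TV] TJ]; split=> [g Sg|x y Tx Ty g Sg|x Tx g Sg].
- by rewrite comm1g.
- have -> : [~ x * y, g] = [~ x, g] ^ y * [~ y, g] by group_id.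
  by apply: TM; [apply/TJ/Tx|apply: Ty].
have -> : [~ x^-1, g] = ([~ x, g] ^ x^-1)^-1 by group_id.
exact/TV/TJ/Tx.
Qed.

Lemma lower_centralS i : 0 < i ->
  lower_central G i.+1 = commutator (lower_central G i) [set: G].
Proof. by case: i. Qed.

Lemma lower_central_normal i : normal (lower_central G i).
Proof.
elim: i => [|[|i] IHi]; [exact: normalT|exact: normalT|].
by rewrite lower_centralS //; apply: commutator_normal (normalT G).
Qed.

Lemma lower_central_le i j : i <= j -> lower_central G j `<=` lower_central G i.
Proof.
move=> /subnKC <-; elim: (j - i)%N => [|d IHd]; first by rewrite addn0.
rewrite addnS; have [/eqP|id_gt0] := posnP (i + d).
  by rewrite addn_eq0 => /andP[/eqP-> _].
rewrite lower_centralS //; have [sg _] := lower_central_normal i.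
apply: generated_min => // _ [x /IHd Gx [g _ <-]].
by apply: normal_commgl => //; apply: lower_central_normal.
Qed.

Lemma lower_central_commg i x g : 0 < i -> lower_central G i x ->
  lower_central G i.+1 [~ x, g].
Proof. by move=> i_gt0 Gx; rewrite lower_centralS //; apply: mem_commutator. Qed.

(** The weight is [n.+1], as [y] precedes the [n] entries of [ys]. *)
Definition left_normed n : set G :=
  [set x | exists y ys, size ys = n /\ x = foldl (@commg G) y ys].

Lemma left_normed_lower_central n : left_normed n `<=` lower_central G n.+1.
Proof.
move=> _ [y [ys [<- ->]]]; elim/last_ind: ys => // ys g IHys.
by rewrite foldl_rcons size_rcons; apply: lower_central_commg.
Qed.

(** Conjugates of left-normed commutators are left-normed, so they generate a normal subgroup [T].
    The elements central modulo [T] form a subgroup, which contains the left-normed commutators of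
    weight one less. *)
Lemma lower_central_left_normed n :
  lower_central G n.+1 `<=` generated (left_normed n).
Proof.
elim: n => [|n IHn].
  by move=> x _; apply: sub_generated; exists x, [::].
have nT : normal (generated (left_normed n.+1)).
  split; first exact: generated_subgroup.
  move=> x g; apply: generated_conj => _ [y [ys [sys ->]]].
  apply: sub_generated; exists (y ^ g), [seq z ^ g | z <- ys].
  rewrite size_map; split=> // {sys}.
  by elim: ys y => //= z ys IHys y; rewrite IHys conjRg.
rewrite lower_centralS //; apply: generated_min; first by have [] := nT.
move=> _ [x /IHn x_gen [g _ <-]].
have := generated_min (@commutes_mod_subgroup _ [set: G] nT).
move/(_ (left_normed n)); apply=> // _ [y [ys [sys ->]]] h _.
apply: sub_generated; exists y, (rcons ys h).
by rewrite size_rcons sys foldl_rcons.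
Qed.

End LowerCentral.

(** * Elements that shift a filtration *)

Section Filtration.
Variable G : groupType.
Variable E : nat -> set G.
Implicit Types (x y c e g : G) (i j l : nat).

Hypothesis E_subgroup : forall l, subgroup (E l).
Hypothesis E_le : forall l, E l `<=` E 0.
Hypothesis E_conj : forall l x e, E l x -> E 0 e -> E l (x ^ e).

Definition normalises g := forall l x, E l x -> E l (x ^ g).

(** In an infinite group [g] may conjugate [E l] into a proper subgroup of itself, hence the
    separate condition on [g^-1]. *)
Definition shifts j g :=
  [/\ normalises g, normalises g^-1 & forall l x, E l x -> E (l + j) [~ x, g]].

Lemma shiftsV j g : shifts j g -> shifts j g^-1.
Proof.
move=> [ng nV sg]; split; rewrite ?invgK // => l x Ex.
have -> : [~ x, g^-1] = [~ x ^ g^-1, g]^-1 by group_id.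
by have [_ _ EV] := E_subgroup (l + j); apply/EV/sg/nV.
Qed.

(** As in the three subgroups lemma, each factor of the identity is shifted once by [c] and once by
    [y], up to inverses. The outer conjugations are harmless: by [E_conj] for [e], by normalisation
    for [c] and [y]. *)
Lemma shifts_commg i j c y : shifts i c -> shifts j y -> shifts (i + j) [~ c, y].
Proof.
move=> sc sy; have [nc nVc shc] := sc; have [ny nVy shy] := sy.
have conj_commg x a b : x ^ [~ a, b] = (((x ^ a^-1) ^ b^-1) ^ a) ^ b by group_id.
split=> [l x Ex|l x Ex|l e Ee].
- by rewrite conj_commg; apply/ny/nc/nVy/nVc.
- by rewrite invgR conj_commg; apply/nc/ny/nVc/nVy.
have [_ _ shVc] := shiftsV sc; have [_ _ shVy] := shiftsV sy.
have [_ EM EV] := E_subgroup (l + (i + j)).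
(* Hall-Witt *)
have -> : [~ e, [~ c, y]] =
    ([~ [~ y^-1, e^-1], c] ^ e * [~ [~ e, c^-1], y^-1] ^ c) ^ y.
  by group_id.
apply: ny; apply: EM.
  apply: E_conj (E_le Ee); rewrite [(i + j)%N]addnC addnA; apply: shc.
  rewrite -invgR; have [_ _ EV'] := E_subgroup (l + j).
  by apply/EV'/shVy; have [_ _ EVl] := E_subgroup l; apply: EVl.
by apply: nc; rewrite addnA; apply/shVy/shVc.
Qed.

Lemma shifts_foldl y (ys : seq G) : shifts 1 y ->
  (forall z, z \in ys -> shifts 1 z) ->
  shifts (size ys).+1 (foldl (@commg G) y ys).
Proof.
move=> sy; elim/last_ind: ys => [|ys z IHys] // shz.
rewrite foldl_rcons size_rcons -addn1; apply: shifts_commg.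
  by apply: IHys => u uys; apply: shz; rewrite mem_rcons inE uys orbT.
by apply: shz; rewrite mem_rcons mem_head.
Qed.

End Filtration.

(** * Descent along the lower central series *)

Lemma setprod_normal (G : groupType) (H K : set G) :
  normal H -> normal K -> normal (setprod H K).
Proof.
move=> [sH HJ] [sK KJ]; split.
  by apply: setprod_subgroup => // x y Hx _; apply: HJ.
move=> _ g [x Hx [y Ky <-]]; exists (x ^ g); first exact: HJ.
by exists (y ^ g); [apply: KJ|rewrite conjMg].
Qed.

(** * A normal subgroup that is abelian modulo a finite one *)

Section AbelianModulo.
Variables (G : groupType) (P A : set G) (m p : nat).
Hypotheses (nP : normal P) (nA : normal A) (PA : P `<=` A).
Hypothesis abA : forall a b, A a -> A b -> P [~ a, b].
Hypothesis Am : forall x, bounded [set x ^ a | a in A] m.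
Hypothesis Pp : bounded P p.
Implicit Types (x y a : G) (ys : seq G).

Definition commutators_mod y : set G := setprod [set [~ a, y] | a in A] P.

(** Modulo [P] the group [A] is abelian, so [a] to [[~ a, y]] is an endomorphism of it and has a
    subgroup as image. *)
Lemma commutators_mod_subgroup y : subgroup (commutators_mod y).
Proof.
have [[P_1 PM PV] PJ] := nP; have [[A1 AM AV] AJ] := nA; split.
- by exists 1; [exists 1; rewrite ?comm1g|exists 1; rewrite ?mulg1].
- move=> _ _ [_ [a Aa <-] [q Pq <-]] [_ [b Ab <-] [r Pr <-]].
  exists [~ a * b, y]; first by exists (a * b) => //; apply: AM.
  exists (([~ [~ a, y], b]^-1 * q) ^ [~ b, y] * r); last by group_id.
  apply: (PM) => //; apply/PJ/PM => //; apply/PV/abA => //.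
  exact: normal_commgl.
move=> _ [_ [a Aa <-] [q Pq <-]].
exists [~ a^-1, y]; first by exists a^-1 => //; apply: AV.
exists (([~ [~ a, y], a^-1] * q^-1) ^ [~ a, y]^-1); last by group_id.
by apply/PJ/PM; [apply: abA; [apply: normal_commgl|apply: AV]|apply: PV].
Qed.

Lemma commutators_mod_le y : commutators_mod y `<=` A.
Proof.
have [[_ AM _] _] := nA; move=> _ [_ [a Aa <-] [q Pq <-]].
by apply: AM (PA Pq); apply: normal_commgl.
Qed.

Fixpoint span_mod ys : set G :=
  if ys is y :: ys' then setprod (commutators_mod y) (span_mod ys') else P.

Lemma span_mod_P ys : P `<=` span_mod ys.
Proof.
elim: ys => //= y ys IHys x Px; exists 1; last by exists x; [apply: IHys|rewrite mul1g].
by have [] := commutators_mod_subgroup y.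
Qed.

Lemma span_mod_le ys : span_mod ys `<=` A.
Proof.
elim: ys => //= y ys IHys _ [x /commutators_mod_le Ax [z /IHys Az <-]].
by have [[_ AM _] _] := nA; apply: AM.
Qed.

Lemma span_mod_subgroup ys : subgroup (span_mod ys).
Proof.
elim: ys => [|y ys IHys] /=; first by have [] := nP.
apply: setprod_subgroup => //; first exact: commutators_mod_subgroup.
move=> x a Sx /span_mod_le Aa.
have -> : x ^ a = x * [~ x, a] by group_id.
have [c1 cM _] := commutators_mod_subgroup y; apply: cM => //.
exists 1; first by exists 1; rewrite ?comm1g //; have [[]] := nA.
exists [~ x, a]; last by rewrite mul1g.
by apply: abA => //; apply: commutators_mod_le Sx.
Qed.

Lemma mem_span_mod ys y a : y \in ys -> A a -> span_mod ys [~ a, y].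
Proof.
elim: ys => //= z ys IHys; rewrite inE => /predU1P[<-|yys] Aa.
  exists [~ a, y]; last first.
    by exists 1; [have [] := span_mod_subgroup ys|rewrite mulg1].
  by exists [~ a, y]; [exists a|exists 1; rewrite ?mulg1; have [[]] := nP].
exists 1; first by have [] := commutators_mod_subgroup z.
by exists [~ a, y]; [apply: IHys|rewrite mul1g].
Qed.

Lemma bounded_span_mod ys : bounded (span_mod ys) ((m * p) ^ size ys * p)%N.
Proof.
elim: ys => [|y ys IHys] /=; first by rewrite mul1n.
rewrite expnS -mulnA; apply: bounded_image2 IHys.
(* Since [[~ a, y] = y^-1 ^ a * y], there are at most [m] such commutators. *)
apply: bounded_image2 Pp; apply: bounded_sub (bounded_image (mul^~ y) (Am y^-1)).
move=> _ [a Aa <-]; exists (y^-1 ^ a); first by exists a.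
by group_id.
Qed.

End AbelianModulo.

(** Here [p] bounds [P], and [(m * p) ^ n * p] bounds [R]. Adding [N1] and 1 gives a positive bound
    valid both for left-normed commutators and for [L]; products of [m.*2] such letters then reach
    all of [K]. *)
Definition step_bound m n N1 N :=
  let p := (bfc_bound m N1 * bfc_bound m N)%N in
  (((m * p) ^ n * p + N1).+1 ^ m.*2)%N.

Lemma class_step (G : groupType) (L C : set G) i n m N1 N :
  let K := lower_central G n in let D j := lower_central G j `&` C in
  0 < i -> i < n ->
  (forall x, bounded [set x ^ k | k in K] m) ->
  normal L -> L `<=` K -> separated L K m ->
  (forall l, L l -> bounded [set l ^ g | g in [set: G]] N1) ->
  normal C -> L `<=` C -> (forall k c, K k -> C c -> L [~ k, c]) ->
  (forall k, K k -> bounded [set k ^ c | c in D i.+1] N) ->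
  forall k, K k -> bounded [set k ^ c | c in D i] (step_bound m n N1 N).
Proof.
move=> K D i_gt0 lt_in Km nL LK sepL LN1 nC LC KCL KN.
have nK : normal K by apply: lower_central_normal.
have nD j : normal (D j) by apply: normalI => //; apply: lower_central_normal.
have DK j : j >= n -> D j `<=` K by move=> nj x [/(lower_central_le nj)].
have D_le j l : j <= l -> D l `<=` D j.
  by move=> jl x [Gx Cx]; split=> //; apply: lower_central_le Gx.
have D_commg j x g : 0 < j -> D j x -> D j.+1 [~ x, g].
  move=> j_gt0 [Gx Cx]; split; first exact: lower_central_commg.
  exact: normal_commgl.
set P1 := commutator L [set: G]; set P2 := commutator K (D i.+1).
pose P := setprod P1 P2.
have nP : normal P by apply: setprod_normal; apply: commutator_normal.
have bP : bounded P (bfc_bound m N1 * bfc_bound m N).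
  apply: bounded_image2; apply: bounded_bfc => // x _.
  by apply: bounded_sub (Km x) => _ [l /LK Kl <-]; exists l.
have [sP PJ] := nP; have [P_1 PM PV] := sP.
have P_L x g : L x -> P [~ x, g].
  move=> Lx; exists [~ x, g]; first exact: mem_commutator.
  by exists 1; [have [[]] := commutator_normal nK (nD i.+1)|rewrite mulg1].
have P_K k c : K k -> D i.+1 c -> P [~ k, c].
  move=> Kk Dc; exists 1; first by have [[]] := commutator_normal nL (normalT G).
  by exists [~ k, c]; [apply: mem_commutator|rewrite mul1g].
have [sL LJ] := nL; have [L1 LM LV] := sL.
have PL : P `<=` L.
  move=> _ [x P1x [y P2y <-]]; apply: LM.
    apply: generated_min P1x => // _ [l Ll [g _ <-]]; exact: normal_commgl.
  apply: generated_min P2y => // _ [k Kk [c [_ Cc] <-]]; exact: KCL.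
pose A := D n.
have LA : L `<=` A by move=> x Lx; split; [apply: LK|apply: LC].
have nA : normal A := nD n.
have PA : P `<=` A by move=> x /PL/LA.
have AK : A `<=` K by apply: DK.
have abA a b : A a -> A b -> P [~ a, b].
  by move=> /AK Ka Ab; apply: P_K => //; apply: D_le Ab.
have Am x : bounded [set x ^ a | a in A] m.
  by apply: bounded_sub (Km x) => _ [a /AK Ka <-]; exists a.
have AcP a y c : A a -> D i c -> P [~ [~ a, y], c].
  move=> Aa Dc; have [[_ _ AV] _] := nA.
  (* Hall-Witt *)
  have -> : [~ [~ a, y], c] =
    (([~ [~ c, a^-1], y^-1] ^ a)^-1 * ([~ [~ y^-1, c^-1], a] ^ c)^-1) ^ y.
    by group_id.
  (* The first factor lies in [[L, G]], as [c] acts trivially on [K] modulo [L]; the second lies in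
     [[D i.+1, K]], as [[~ y^-1, c^-1]] is in [D i.+1]. *)
  apply/PJ/PM; apply/PV/PJ.
    apply/P_L; rewrite -invgR; apply/LV/KCL; first exact/AK/AV.
    by case: Dc.
  rewrite -invgR; apply/PV/P_K; first exact: AK.
  rewrite -invgR; have [[_ _ DV] _] := nD i.+1; apply/DV/D_commg => //.
  by have [[_ _ DVi] _] := nD i; apply: DVi.
have bR ys := bounded_span_mod Am bP ys.
set p := (_ * _)%N in bP bR.
have b_left : forall b, left_normed n.-1 b ->
    bounded [set b ^ c | c in D i] ((m * p) ^ n * p)%N.
  move=> _ [y [ys [sys ->]]]; pose R := span_mod P A (y :: ys).
  have sR : subgroup R by apply: span_mod_subgroup.
  have [R1 RM RV] := sR.
  have RA : R `<=` A by apply: span_mod_le.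
  have PR : P `<=` R by apply: span_mod_P.
  have AR a z : z \in y :: ys -> A a -> R [~ a, z] by move=> *; apply: mem_span_mod.
  (* [D i] centralises [R] modulo [P], hence normalises [R], as the filtration below requires. *)
  have RcP x c : R x -> D i c -> P [~ x, c].
    have [W1 WM WV] := @commutes_mod_subgroup _ P (D i) nP.
    suff RW zs z : span_mod P A zs z ->
        [set a | forall g, D i g -> P [~ a, g]] z.
      by move=> /RW; apply.
    elim: zs z => [z Pz g _|u zs IHzs _ [_ [_ [a Aa <-] [q Pq <-]] [z /IHzs Wz <-]]].
      exact: normal_commgl.
    apply: (WM) (Wz); apply: WM => [g|g _]; first exact: AcP.
    exact: normal_commgl.
  (* The terms 0 to [n - i] are [D i] to [D n]; all later ones are [R]. *)
  pose E l := if l <= n - i then D (i + l) else R.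
  have ED l : E l `<=` D i.
    rewrite /E; case: ifP => _; first by apply: D_le; apply: leq_addr.
    by move=> x /RA; apply: D_le; apply: ltnW.
  have E0 : E 0 = D i by rewrite /E addn0.
  have E_sub l : subgroup (E l) by rewrite /E; case: ifP => // _; have [] := nD (i + l).
  have E_le l : E l `<=` E 0 by rewrite E0.
  have conjE (x g : G) : x ^ g = x * [~ x, g] by group_id.
  have E_conj l x e : E l x -> E 0 e -> E l (x ^ e).
    rewrite E0 /E; case: ifP => _ Ex De; first by have [_] := nD (i + l); apply.
    by rewrite conjE; apply: RM => //; apply/PR/RcP.
  have RJ x z : z \in y :: ys -> R x -> R (x ^ z).
    by move=> zys Rx; rewrite conjE; apply: RM => //; apply: AR => //; apply: RA.
  have RJV x z : z \in y :: ys -> R x -> R (x ^ z^-1).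
    move=> zys Rx; rewrite conjE; apply: RM => //.
    have -> : [~ x, z^-1] = [~ x ^ z^-1, z]^-1 by group_id.
    by apply/RV/AR => //; have [_ AJ] := nA; apply/AJ/RA.
  have sh z : z \in y :: ys -> shifts E 1 z.
    move=> zys; split=> l x; rewrite /E.
    - by case: ifP => _; [have [_] := nD (i + l); apply|apply: RJ].
    - by case: ifP => _; [have [_] := nD (i + l); apply|apply: RJV].
    (* Below [n - i] this is the lower central series; from there on, [R] lies in [A] and contains
       every [[~ a, z]] with [a] in [A]. *)
    rewrite addn1; case: (ltngtP l (n - i)) => [lt_l|gt_l|->].
    - by rewrite addnS; apply: D_commg; rewrite addn_gt0 i_gt0.
    - by move=> /RA; apply: AR.
    - by rewrite subnKC ?(ltnW lt_in) // => Ax; apply: AR.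
  have [||_ _ shb] := @shifts_foldl _ E E_sub E_le E_conj y ys.
  - by apply: sh; rewrite mem_head.
  - by move=> z zys; apply: sh; rewrite inE zys orbT.
  set b := foldl _ _ _ in shb *.
  (* Here [b ^ c = b * [~ c, b]^-1]. The shift of [b] is [n], which exceeds [n - i], so [[~ c, b]]
     lies in [R]. *)
  have := bounded_image (fun r => b * r^-1) (bR (y :: ys)).
  rewrite /= sys prednK ?(leq_trans i_gt0 (ltnW lt_in)) //.
  apply: bounded_sub => _ [c Dc <-]; exists [~ c, b]; last by group_id.
  have := shb 0 c; rewrite E0 => /(_ Dc); rewrite /E add0n sys.
  rewrite prednK ?(leq_trans i_gt0 (ltnW lt_in)) //.
  by rewrite leqNgt ltn_subrL i_gt0 (leq_trans i_gt0 (ltnW lt_in)).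
set N2 := ((m * p) ^ n * p + N1).+1.
(* [X] inherits separation from [L] and contains the left-normed generators of [K]. *)
pose X := [set k | K k /\ bounded [set k ^ c | c in D i] N2].
have LX : L `<=` X.
  move=> l Ll; split; first exact: LK.
  apply: bounded_le (leqW (leq_addl _ _)) _.
  by apply: bounded_sub (LN1 l Ll) => _ [c _ <-]; exists c.
move=> k Kk; rewrite /step_bound -/p -/N2.
apply: (@bounded_conj_generated _ _ K X) => //; first by have [] := nK.
- by move=> x [].
- by apply: sub_separated sepL.
have n_gt0 : 0 < n := leq_trans i_gt0 (ltnW lt_in).
have KX : lower_central G n.-1.+1 `<=` generated (@left_normed G n.-1).
  exact: lower_central_left_normed.
rewrite prednK // in KX; apply: generated_min (KX k Kk).
  exact: generated_subgroup.
move=> b lb; apply: sub_generated; split.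
  by have := left_normed_lower_central lb; rewrite prednK.
by apply: bounded_le (b_left b lb); apply/leqW/leq_addr.
Qed.

(** After [d] steps from [D_n] this bounds the conjugates of [k] in [K] under [D_(n-d)]. *)
Fixpoint descent_bound m n d :=
  if d is d'.+1 then
    step_bound m n (class_bound m ^ m.*2)%N (descent_bound m n d')
  else m.

Lemma stabilizer_quotient_normal (G : groupType) (K L : set G) :
  normal K -> normal L ->
  normal [set g | forall k, K k -> L [~ k, g]].
Proof.
move=> [_ KJ] [[L1 LM LV] LJ]; split; first split.
- by move=> k _; rewrite commg1.
- move=> x y Cx Cy k Kk.
  have -> : [~ k, x * y] = [~ k, y] * [~ k, x] ^ y by group_id.
  by apply: LM; [apply: Cy|apply/LJ/Cx].
- move=> x Cx k Kk.
  have -> : [~ k, x^-1] = [~ k ^ x^-1, x]^-1 by group_id.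
  exact/LV/Cx/KJ.
move=> x g Cx k Kk; rewrite -[k](conjgKV g) -conjRg.
exact/LJ/Cx/KJ.
Qed.

(** There are at most [m ^ m] maps on coset representatives of [L] in [K], and elements of [G]
    inducing the same map differ by an element of [C]. *)
Lemma bounded_conj_finite_index (G : groupType) (K L : set G) m N :
  let C := [set g | forall k, K k -> L [~ k, g]] in
  normal K -> normal L -> L `<=` K -> separated L K m ->
  (forall k, K k -> bounded [set k ^ c | c in C] N) ->
  forall k, K k -> bounded [set k ^ g | g in [set: G]] (m ^ m * N)%N.
Proof.
move=> C [[K1 KM KV] KJ] [[L1 LM LV] LJ] LK sep KN k Kk.
have [ks [sks ksK repK]] := separated_reps sep.
have m_gt0 : 0 < m.
  by apply: leq_trans sks; case: (ks) (repK 1 K1) => // -[].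
pose rep x := xget 1 [set y | y \in ks /\ L (y^-1 * x)].
have repP x : K x -> rep x \in ks /\ L ((rep x)^-1 * x).
  move=> /repK[y yks Lyx].
  exact: (@xgetPex _ 1 [set y | y \in ks /\ L (y^-1 * x)]) (ex_intro _ y (conj yks Lyx)).
have bf : bounded [set [seq rep (b ^ g) | b <- ks] | g in [set: G]] (m ^ m)%N.
  apply: bounded_le (@bounded_map _ _ _ (fun b g => rep (b ^ g)) ks m _).
    by rewrite leq_pexp2l.
  move=> b /ksK Kb; exists ks => // _ [g _ <-].
  by have [] := repP (b ^ g) (KJ _ _ Kb).
have [T [sT _ repT]] := bounded_fibers bf.
have bT : bounded [set` T] (m ^ m)%N by exists T.
have := bounded_bigcup bT (fun t _ => bounded_image (conjg^~ t) (KN k Kk)).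
apply: bounded_sub => _ [g _ <-].
have [t tT eq_t] := repT g I; exists t => //.
exists (k ^ (g / t)); last by rewrite conjgM conjgKV.
exists (g / t) => // h Kh.
have [b bks Lbh] := repK h Kh.
have /eq_in_map/(_ b bks) eq_r := eq_t.
have [_ Lt] := repP (b ^ t) (KJ _ _ (ksK b bks)).
have [_ Lg] := repP (b ^ g) (KJ _ _ (ksK b bks)).
(* With [h = b * l] and [l] in [L], the elements [b ^ t] and [b ^ g] share a representative, so
   [h ^ t] and [h ^ g] agree modulo [L]. *)
have -> : [~ h, g / t] = (((b^-1 * h) ^ t)^-1 *
   (((rep (b ^ t))^-1 * b ^ t)^-1 * ((rep (b ^ t))^-1 * b ^ g)) *
   (b^-1 * h) ^ g) ^ t^-1 by group_id.
apply/LJ/LM; last exact: LJ.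
apply: (LM); first by apply/LV/LJ.
by apply: LM; [apply: LV|rewrite eq_r].
Qed.

Definition lower_central_bound m n :=
  bfc_bound m (m ^ m * descent_bound m n n.-1).

Lemma bounded_lower_central (G : groupType) m n : 0 < n ->
  (forall x : G, bounded [set x ^ k | k in lower_central G n] m) ->
  bounded (lower_central G n.+1) (lower_central_bound m n).
Proof.
move=> n_gt0 Km; have nK := lower_central_normal G n.
have [L [nL LK sepL LN]] := fc_subgroup nK Km.
set K := lower_central G n in Km nK LK sepL *.
pose C := [set g | forall k, K k -> L [~ k, g]].
have nC : normal C by apply: stabilizer_quotient_normal.
have KD d : d < n -> forall k, K k ->
    bounded [set k ^ c | c in lower_central G (n - d) `&` C] (descent_bound m n d).
  elim: d => [_|d IHd lt_dn] k Kk.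
    by rewrite subn0; apply: bounded_sub (Km k) => _ [c [Kc _] <-]; exists c.
  apply: (@class_step _ L) => //; rewrite ?subn_gt0 ?ltn_subrL //.
  - by move=> l Ll k' _; apply: normal_commgr.
  - by move=> k' c Kk' /(_ k' Kk').
  by rewrite (subnSK (ltnW lt_dn)); exact: IHd (ltnW lt_dn).
rewrite lower_centralS //; apply: bounded_bfc => //.
apply: bounded_conj_finite_index nK nL LK sepL _ => k Kk.
(* After [n.-1] steps the descent has reached [D_1], which is [C]. *)
have := KD n.-1 _ k Kk; rewrite prednK // leqnn => /(_ isT).
rewrite -subn1 subKn //; apply: bounded_sub => _ [c Cc <-].
by exists c.
Qed.

(** * Covering lists and cardinal inequalities *)

Lemma card_le_bounded (T : choiceType) (X : set T) N : X #<= `I_N -> bounded X N.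
Proof.
move=> /pcard_leP/injfunPex[f fX f_inj]; apply: uniq_bounded => s sX us.
rewrite -(size_iota 0 N) -(size_map f); apply: uniq_leq_size.
  by rewrite map_inj_in_uniq // => x y /sX Xx /sX Xy; apply: f_inj; rewrite inE.
by move=> _ /mapP[x /sX/fX fx ->]; rewrite mem_iota.
Qed.

Lemma bounded_card_le (T : choiceType) (X : set T) N :
  bounded X N -> finite_set X /\ X #<= `I_N.
Proof.
move=> [r sr Xr].
suff XN : X #<= `I_N by split=> //; apply/finite_set_leP; exists N.
apply/pcard_leP/injfunPex; exists (index^~ r) => [x /Xr xr /=|x y].
  by rewrite (leq_trans _ sr) // index_mem.
by rewrite !inE => /Xr xr /Xr yr; apply: index_inj.
Qed.

Local Close Scope group_scope.

Theorem theorem1p2 :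
  exists f : nat -> nat -> nat,
    (forall m n : nat, 0 < m -> 0 < n -> 0 < f m n) /\
    (forall m n : nat, 0 < m -> 0 < n ->
     forall G : groupType,
       (forall x : G, [set (x ^ s)%g | s in lower_central G n] #<= `I_m) ->
       finite_set (lower_central G n.+1) /\
       lower_central G n.+1 #<= `I_(f m n)).
Proof.
(* The successor only serves to make [f] positive. *)
exists (fun m n => (lower_central_bound m n).+1); split=> // m n _ n_gt0 G Gm.
apply/bounded_card_le/(bounded_le (leqnSn _))/bounded_lower_central => // x.
exact/card_le_bounded.
Qed.
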